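(* Let $\tau=\{m-n+1,\dots,m-1,m\}$. Then the following bounds hold for the $i$-th entry of $\omega_{(\tau)}$: $$\omega_{(\tau),i}<1-(c-1)^n<1\quad\text{for } i\notin\tau \text{ and } n \text{ even},$$ $$\omega_{(\tau),i}>1+(c-1)^n>1\quad\text{for } i\notin\tau \text{ and } n \text{ odd},$$ with $c=\dfrac{\lambda_{m-n}}{\lambda_{m-n+1}}>1$.
   Context: Let $1\le n<m$ be integers and let $\lambda_1>\lambda_2>\cdots>\lambda_m>0$ be real numbers; $\Lambda=\operatorname{diag}(\lambda)$; the index $i$ ranges over $[m]=\{1,\dots,m\}$. $\mathbf 1$ is the all-ones vector. $V$ is the $m\times n$ Vandermonde matrix with $V_{i,k}=\lambda_i^{k-1}$. For an $n$-element subset $\tau\subseteq[m]$, $S_\tau$ is the $m\times n$ selection matrix such that $S_\tau^Tx$ is the subvector of $x\in\mathbb{R}^m$ with entries indexed by $\tau$, and $\omega_{(\tau)}=\Lambda V(S_\tau^T\Lambda V)^{-1}\mathbf 1\in\mathbb{R}^m$ (the PLS shrinkage vector when the response vector is supported exactly on $\tau$).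
   Formalization: For n = 1 and i = m−1 the strict bound ω_i > 1+(c−1)^n fails, since ω_i = c = 1+(c−1) (e.g. m = 2, λ = (2,1)); in that single case equality is stated instead, and every other case is as in the text. *)

(* Defs.v *)
From mathcomp Require Import all_boot all_order all_algebra.

Set Implicit Arguments.
Unset Strict Implicit.
Unset Printing Implicit Defensive.

Import Order.TTheory GRing.Theory Num.Theory.
Local Open Scope ring_scope.

(* The library's [Vandermonde] has the powers along the rows, hence the
   transpose: the entry (i, k) of [vander n lam] is lam_i ^+ k, k < n. *)
Definition vander (R : realFieldType) (m n : nat) (lam : 'rV[R]_m) : 'M[R]_(m, n) :=
  (Vandermonde n lam)^T.

(* Column k is the basis vector of the k-th element of tau, in increasing
   order, so (selmx htau)^T *m x is the subvector of x indexed by tau. *)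
Definition selmx (R : realFieldType) (m n : nat) (tau : {set 'I_m})
    (htau : #|tau| = n) : 'M[R]_(m, n) :=
  \matrix_(i < m, k < n) (i == enum_val (cast_ord (esym htau) k))%:R.

(* The inverted matrix is nonsingular whenever the lam_i are nonzero and
   pairwise distinct, so the default value of [invmx] plays no role then. *)
Definition omega (R : realFieldType) (m n : nat) (lam : 'rV[R]_m)
    (tau : {set 'I_m}) (htau : #|tau| = n) : 'cV[R]_m :=
  let LV := diag_mx lam *m vander n lam in
  LV *m invmx ((selmx R htau)^T *m LV) *m const_mx 1.

(* Main.v *)
Require Import Defs.
From mathcomp Require Import all_boot all_order all_algebra.

Import Order.TTheory GRing.Theory Num.Theory.
Local Open Scope ring_scope.

(* The i-th entry of [omega] is q(lam_i), where q is the polynomial of degree at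
   most n with q(0) = 0 and q(lam_j) = 1 for j in tau. By uniqueness of
   interpolation, q(x) = 1 - prod_(j in tau) (1 - x / lam_j). For i outside tau
   every factor lam_i / lam_j - 1 is at least c - 1 > 0, with strict inequality
   unless i and j are the two adjacent indices defining c. *)

Section ShrinkagePolynomial.

Variables (R : realFieldType) (m n : nat) (lam : 'rV[R]_m).
Variables (tau : {set 'I_m}) (htau : #|tau| = n).

Let node (k : 'I_n) : 'I_m := enum_val (cast_ord (esym htau) k).

Lemma node_in k : node k \in tau. Proof. exact: enum_valP. Qed.

Lemma node_inj : injective node.
Proof. by move=> k l /enum_val_inj /cast_ord_inj. Qed.

Definition shrink_poly : {poly R} :=
  1 - \prod_(j in tau) (1 - (lam 0 j)^-1 *: 'X).

Lemma horner_shrink_poly x :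
  shrink_poly.[x] = 1 - \prod_(j in tau) (1 - x / lam 0 j).
Proof.
rewrite /shrink_poly hornerD hornerN hornerC horner_prod; congr (1 - _).
by apply: eq_bigr => j _; rewrite !hornerE mulrC.
Qed.

Lemma size_shrink_poly : (size shrink_poly <= n.+1)%N.
Proof.
apply: leq_trans (size_polyD _ _) _.
rewrite geq_max size_polyN size_poly1 /=.
(* A product of [n] factors has size at most the sum of their sizes plus 1 minus [n]; each factor is
   affine, of size at most 2, so a sum of at most [n + n] suffices. *)
apply: leq_trans (size_poly_prod_leq _ _) _; rewrite htau leq_subLR addnS ltnS.
rewrite -[X in (_ <= X + X)%N]htau addnn -mul2n mulnC -sum_nat_const.
apply: leq_sum => j _; apply: leq_trans (size_polyD _ _) _.
rewrite geq_max size_polyN size_poly1 /=.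
by apply: leq_trans (size_scale_leq _ _) _; rewrite size_polyX.
Qed.

(** At 0 the product is 1, so the constant coefficient vanishes; the exponents 1 to [n] that remain
    are those in the columns of [diag_mx lam *m vander n lam]. *)
Lemma shrink_poly_expand x :
  shrink_poly.[x] = \sum_(l < n) x ^+ l.+1 * shrink_poly`_l.+1.
Proof.
rewrite (horner_coef_wide _ size_shrink_poly) big_ord_recl -horner_coef0.
rewrite horner_shrink_poly big1 => [|j _]; last by rewrite mul0r subr0.
rewrite subrr mul0r add0r.
by apply: eq_bigr => l _; rewrite mulrC.
Qed.

Lemma scaled_vanderE i l :
  (diag_mx lam *m vander n lam) i l = lam 0 i ^+ l.+1.
Proof. by rewrite mul_diag_mx !mxE exprS. Qed.

Lemma selmx_mulE p (A : 'M[R]_(m, p)) k l :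
  ((selmx R htau)^T *m A) k l = A (node k) l.
Proof.
rewrite mxE (bigD1 (node k)) //= !mxE eqxx mul1r big1 ?addr0 // => j jk.
by rewrite !mxE (negPf jk) mul0r.
Qed.

Hypothesis lam_inj : injective (lam 0).
Hypothesis lam_neq0 : forall i, lam 0 i != 0.

(** Keeping the rows in [tau] leaves a diagonal matrix times a square Vandermonde matrix on the
    nodes, whose determinants are products of nonzero nodes and of differences of distinct nodes. *)
Lemma selected_vander_unit :
  (selmx R htau)^T *m (diag_mx lam *m vander n lam) \in unitmx.
Proof.
pose a : 'rV[R]_n := \row_k lam 0 (node k).
have -> : (selmx R htau)^T *m (diag_mx lam *m vander n lam)
    = diag_mx a *m (Vandermonde n a)^T.
  apply/matrixP=> k l.
  by rewrite selmx_mulE scaled_vanderE mul_diag_mx !mxE exprS.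
rewrite unitmx_mul unitmx_tr !unitmxE det_diag det_Vandermonde !unitfE.
apply/andP; split; apply/prodf_neq0 => k _; first by rewrite mxE.
apply/prodf_neq0 => l kl; rewrite !mxE subr_eq0.
by apply: contraTneq kl => /lam_inj /node_inj ->; rewrite ltnn.
Qed.

Lemma omegaE i :
  omega lam htau i 0 = 1 - \prod_(j in tau) (1 - lam 0 i / lam 0 j).
Proof.
rewrite -horner_shrink_poly shrink_poly_expand /omega /=.
set LV := diag_mx lam *m vander n lam.
(* The coefficients of [shrink_poly] solve the selected system with right-hand side 1, since the
   factor of index [node k] vanishes at that node. Substituting this for the all-ones vector cancels
   the inverse. *)
pose w : 'cV[R]_n := \col_l shrink_poly`_l.+1.
have LVw r : (LV *m w) r 0 = shrink_poly.[lam 0 r].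
  rewrite shrink_poly_expand mxE.
  by apply: eq_bigr => l _; rewrite scaled_vanderE mxE.
have <- : (selmx R htau)^T *m LV *m w = const_mx 1.
  apply/matrixP=> k z; rewrite ord1 -mulmxA selmx_mulE LVw horner_shrink_poly.
  rewrite (bigD1 (node k)) ?node_in //= divff ?lam_neq0 // subrr mul0r subr0.
  by rewrite mxE.
by rewrite -mulmxA mulKmx ?selected_vander_unit // LVw shrink_poly_expand.
Qed.

(** Flipping all [n] factors makes them positive for [i] outside [tau] when [lam] is positive and
    decreasing, so the parity of [n] alone decides the side of 1. *)
Lemma omega_signE i :
  omega lam htau i 0
  = 1 - (-1) ^+ n * \prod_(j in tau) (lam 0 i / lam 0 j - 1).
Proof.
rewrite omegaE -[in (-1) ^+ n]htau -prodrN; congr (1 - _).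
by apply: eq_bigr => j _; rewrite opprB.
Qed.

End ShrinkagePolynomial.

(* Indices are 0-based: jout and jin are the indices m-n and m-n+1 of the usual
   1-based numbering. When n = 1 and i = jout the odd bound is an equality, so
   that single case is separated from the strict inequality. *)
Theorem lemma4p1 (R : realFieldType) (m n : nat) (lam : 'rV[R]_m)
  (tau : {set 'I_m}) (htau : #|tau| = n) (jout jin : 'I_m)
  (n_ge1 : (1 <= n)%N) (n_lt_m : (n < m)%N)
  (lam_decr : forall i j : 'I_m, (i < j)%N -> lam 0 j < lam 0 i)
  (lam_gt0 : forall i : 'I_m, 0 < lam 0 i)
  (tauE : tau = [set i : 'I_m | (m - n <= i)%N])
  (joutE : (jout : nat) = (m - n - 1)%N)
  (jinE : (jin : nat) = (m - n)%N) :
  let c := lam 0 jout / lam 0 jin in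
  [/\ 1 < c,
      forall i : 'I_m, i \notin tau -> ~~ odd n ->
        omega lam htau i 0 < 1 - (c - 1) ^+ n /\ 1 - (c - 1) ^+ n < 1
    & forall i : 'I_m, i \notin tau -> odd n ->
        [/\ ~ (n = 1%N /\ i = jout) -> 1 + (c - 1) ^+ n < omega lam htau i 0,
            n = 1%N /\ i = jout -> omega lam htau i 0 = 1 + (c - 1) ^+ n
          & 1 < 1 + (c - 1) ^+ n]].
Proof.
move=> c.
have lam_le (i j : 'I_m) : (i <= j)%N -> lam 0 j <= lam 0 i.
  rewrite leq_eqVlt => /predU1P[/val_inj -> // | /lam_decr /ltW //].
have lam_inj : injective (lam 0).
  move=> i j eq_ij; apply: val_inj; case: (ltngtP i j) => // /lam_decr.
    by rewrite eq_ij ltxx.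
  by rewrite eq_ij ltxx.
have lam_neq0 i : lam 0 i != 0 by rewrite gt_eqF.
have out_in : (jout < jin)%N by rewrite joutE jinE subn1 prednK // subn_gt0.
have c_gt1 : 1 < c by rewrite ltr_pdivlMr // mul1r lam_decr.
have c1_gt0 : 0 < c - 1 by rewrite subr_gt0.
have cn_gt0 : 0 < (c - 1) ^+ n by rewrite exprn_gt0.
have outP i : i \notin tau -> (i <= jout)%N.
  rewrite tauE inE -ltnNge joutE subn1 => lt_i.
  by rewrite -ltnS prednK // (leq_trans _ lt_i).
have inP j : j \in tau -> (jin <= j)%N by rewrite tauE inE jinE.
have in_jin : jin \in tau by rewrite tauE inE jinE.
(* Since [i <= jout] and [jin <= j], the numerator is at least that of [c] and the denominator at
   most that of [c]. *)
have ratio_ge i j : i \notin tau -> j \in tau -> c <= lam 0 i / lam 0 j.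
  move=> /outP i_out /inP j_in.
  by rewrite ler_pM ?invr_ge0 ?lef_pV2 ?posrE ?lam_le // ltW.
have ratio_gt i j : i \notin tau -> j \in tau -> i != jout \/ j != jin ->
    c < lam 0 i / lam 0 j.
  move=> /outP i_out /inP j_in [neq_i|neq_j].
    have lt_i : (i < jout)%N by rewrite ltn_neqAle i_out andbT.
    apply: (@lt_le_trans _ _ (lam 0 i / lam 0 jin)).
      by rewrite ltr_pM2r ?invr_gt0 // lam_decr.
    by rewrite ler_pM2l // lef_pV2 ?posrE ?lam_le.
  have lt_j : (jin < j)%N by rewrite ltn_neqAle eq_sym neq_j.
  apply: (@lt_le_trans _ _ (lam 0 jout / lam 0 j)).
    by rewrite ltr_pM2l // ltf_pV2 ?posrE // lam_decr.
  by rewrite ler_pM2r ?invr_gt0 // lam_le.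
have prod_gt i : i \notin tau -> ~ (n = 1%N /\ i = jout) ->
    (c - 1) ^+ n < \prod_(j in tau) (lam 0 i / lam 0 j - 1).
  move=> i_out not_eq.
  (* One strict factor is enough: if [i != jout], the one at [jin] is strict; otherwise [n > 1] and
     any other element of [tau] serves. *)
  have [j j_in neq] : exists2 j, j \in tau & i != jout \/ j != jin.
    have [eq_i|neq_i] := eqVneq i jout; last by exists jin => //; left.
    have n_gt1 : (1 < n)%N.
      by rewrite ltn_neqAle n_ge1 andbT; apply/eqP => n1; apply: not_eq.
    have /card_gt0P[j] : (0 < #|tau :\ jin|)%N.
      by move: n_gt1; rewrite -htau (cardsD1 jin) in_jin.
    by rewrite !inE => /andP[neq_j j_in]; exists j => //; right.
  rewrite -htau -prodr_const (bigD1 j) //= [ltRHS](bigD1 j) //=.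
  (* The factor at [j] is replaced first, strictly because the other factors [c - 1] have a positive
     product; the others then follow weakly. *)
  apply: (@lt_le_trans _ _ ((lam 0 i / lam 0 j - 1) *
      \prod_(k in tau | k != j) (c - 1))).
    rewrite ltr_pM2r; first by rewrite ltrD2r ratio_gt.
    by apply: prodr_gt0.
  apply: ler_wpM2l.
    by rewrite subr_ge0 (le_trans (ltW c_gt1)) ?ratio_ge.
  by apply: ler_prod => k /andP[k_in _]; rewrite ltW //= lerD2r ratio_ge.
split=> // i i_out n_par.
  split; last by rewrite gtrBl.
  rewrite omega_signE // -signr_odd (negPf n_par) mul1r ltrD2l ltrN2.
  by apply: prod_gt => // -[n1 _]; rewrite n1 in n_par.
rewrite omega_signE // -signr_odd n_par mulN1r opprK.
split=> [not_eq | [n1 eq_i] |]; last by rewrite ltrDl.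
  by rewrite ltrD2l prod_gt.
(* Here [tau] is the singleton of [jin], so the product is the single factor [c - 1]. *)
have /eqP/cards1P[j tau1] : #|tau| = 1%N by rewrite htau.
move: in_jin; rewrite n1 eq_i tau1 big_set1 inE => /eqP jin_j.
by rewrite expr1 /c jin_j.
Qed.
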